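(* Let $L=(\psi,\varphi,\eta)$ be a terminating tnn-loop over $\mathcal{PV}=\{x_1,\ldots,x_d\}$, let $\psi'=\psi\land\varphi$, and let $\overline{\vec x}=(\overline{x_1},\ldots,\overline{x_d})$ be a normalized closed form for $\eta$ with start value $n_0$ whose components are normalized poly-exponential expressions. Write $\varphi$ as a propositional formula over atoms of the form $s_1<s_2$. For every atom $\alpha=(s_1<s_2)$ of $\varphi$, let $npe_\alpha$ be the normalized poly-exponential expression obtained by multiplying $(s_2-s_1)[\vec x/\overline{\vec x}]$ with the least common multiple of all denominators occurring in it; let $\overline{npe_\alpha}$ be an eventually non-positive over-approximation of $npe_\alpha$ w.r.t. $\psi'$, and let $D_\alpha$ be the corresponding threshold $D$ (both as defined in the context). Write $\overline{npe_\alpha}=\sum_{j=1}^{\ell}p_j\cdot n^{a_j}\cdot b_j^n$ with polynomials $p_j\neq0$ and $(b_\ell,a_\ell)>_{\mathrm{lex}}\cdots>_{\mathrm{lex}}(b_1,a_1)$, and let $C_\alpha=\max\{1,N_2,M_2,\ldots,N_\ell,M_\ell\}$ where for $2\le j\le\ell$: $M_j=0$ if $b_j=b_{j-1}$, and $M_j$ is the $1$-monotonicity threshold of $(b_j,a_j)$ and $(b_{j-1},a_{j-1}+1)$ if $b_j>b_{j-1}$; $N_2=1$, $N_3=mt'$, and $N_j=\max\{mt,mt'\}$ for $j>3$, where $mt'$ is the $(j-2)$-monotonicity threshold of $(b_{j-1},a_{j-1})$ and $(b_{j-2},a_{j-2})$, and $mt=\max\{1\text{-monotonicity threshold of }(b_{j-2},a_{j-2})\text{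 and }(b_i,a_i)\mid1\le i\le j-3\}$. Let $Pol_\alpha=\{p_1,\ldots,p_{\ell-1}\}$, $Pol=\bigcup_\alpha Pol_\alpha$, $C=\max_\alpha C_\alpha$, $D=\max_\alpha D_\alpha$ (over all atoms $\alpha$ of $\varphi$), and ${\operatorname{sth}^{\sqcup}}=2\cdot\sqcup Pol+\max\{n_0,C,D\}\in\mathbb{Z}[\vec x]$. Then for all $\vec e\in\Psi'$ we have $|\sigma_{\vec e}|({\operatorname{sth}^{\sqcup}})\ge\operatorname{sth}_{(\psi,\varphi,\eta)}(\vec e)$. Moreover, if $t_0$ and $t$ are the initial and the looping transition of $L$, then ${\mathcal{RB}_{\text{glo}}}$ with ${\mathcal{RB}_{\text{glo}}}(t_0)=1$ and ${\mathcal{RB}_{\text{glo}}}(t)={\operatorname{sth}^{\sqcup}}$ is a global runtime bound for $L$.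
   Context: Formulas are propositional combinations (with $\land,\lor$) of polynomial inequations $q_1<q_2$ over $\mathbb{Z}[x_1,\ldots,x_d]$. A twn-loop $(\psi,\varphi,\eta)$ over $\mathcal{PV}=\{x_1,\ldots,x_d\}$ is the integer program with locations $\ell_0,\ell$ and the two transitions $t_0=(\ell_0,\psi,\mathrm{id},\ell)$ and $t=(\ell,\varphi,\eta,\ell)$, where $\psi,\varphi$ are formulas over $\mathcal{PV}$, $\models\psi\to\eta(\psi)$ (update-invariant; $\eta(\cdot)$ substitutes $\eta(x_i)$ for $x_i$), and $\eta(x_i)=c_i\cdot x_i+p_i$ with $c_i\in\mathbb{Z}$, $p_i\in\mathbb{Z}[x_{i+1},\ldots,x_d]$. It is a tnn-loop if all $c_i\ge0$. Evaluation: from $(\ell_0,\sigma)$ one may step to $(\ell,\sigma)$ if $\sigma(\psi)$ holds, and from $(\ell,\sigma)$ to $(\ell,\sigma')$ with $\sigma'(x_i)=\sigma(\eta(x_i))$ if $\sigma(\varphi)$ holds. The loop is terminating if no infinite evaluation exists. A global runtime bound for it maps each transition $s\in\{t_0,t\}$ to a bound (built from $\mathbb{N}\cup\{\omega\}$ and variables by $+,\cdot$, exponentiation $k^{b}$) whose value at $|\sigma_0|$ (the absolute values of the initial state) is at least the number of times $s$ is used in any evaluation starting in $(\ell_0,\sigma_0)$. A normalized poly-exponential expression is $\sum_{j=1}^{\ell}p_j\cdot n^{a_j}\cdot b_j^n$ with $\ell,a_j\in\mathbb{N}$, $p_j\in\mathbb{Q}[\vec x]$, $b_j\in\mathbb{N}_{\ge1}$,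 in a distinguished variable $n$. A tuple $\overline{\vec x}$ of expressions over $\vec x,n$ is a normalized closed form for $\eta$ with start value $n_0\ge0$ if $\sigma(\overline{x_i})=\sigma(\eta^n(x_i))$ for all $i$ and all $\sigma$ with $\sigma(n)\ge n_0$. For $\vec e\in\mathbb{Z}^d$, $\sigma_{\vec e}$ maps $x_i\mapsto e_i$; $\Psi$ (resp. $\Psi'$) is the set of $\vec e$ with $\sigma_{\vec e}(\psi)$ (resp. $\sigma_{\vec e}(\psi')$) true. The stabilization threshold $\operatorname{sth}_{(\psi,\varphi,\eta)}(\vec e)$, for $\vec e\in\Psi$, is the smallest $m\in\mathbb{N}$ such that $\sigma_{\vec e}(\eta^{n}(\varphi)\leftrightarrow\eta^{m}(\varphi))$ holds for all $n\ge m$. $(b_1,a_1)>_{\mathrm{lex}}(b_2,a_2)$ means $b_1>b_2$ or ($b_1=b_2$ and $a_1>a_2$); for such pairs and $k\in\mathbb{N}_{\ge1}$ the $k$-monotonicity threshold of $(b_1,a_1)$ and $(b_2,a_2)$ is the smallest $n_0\in\mathbb{N}$ with $n^{a_1}b_1^n>k\cdot n^{a_2}b_2^n$ for all $n\ge n_0$. For polynomials $q_1,\ldots,q_m$, $\sqcup\{q_1,\ldots,q_m\}=\sum_{\vec e}c_{\vec e}\vec x^{\vec e}$ where $c_{\vec e}$ is the maximal absolute value of a coefficient of the monomial $\vec x^{\vec e}$ in any $q_k$ ($0$ if none). Over-approximation: write $npe=\sum_{(p,a,b)\in\Lambda}p\cdot n^a\cdot b^n$ with $\Lambda$ a finite set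 of triples of a monomial $p$ (rational coefficient) and $a,b\in\mathbb{N}$; choose disjoint $\Delta,\Gamma\subseteq\Lambda$ with $\models\psi'\to(p>0)$ for $(p,a,b)\in\Delta$ and $\models\psi'\to(p\le0)$ for $(p,a,b)\in\Gamma$, and numbers $i_{(p,a,b)},j_{(p,a,b)}\in\mathbb{N}$ with $(j,i)>_{\mathrm{lex}}(b,a)$ on $\Delta$ and $(b,a)>_{\mathrm{lex}}(j,i)$ on $\Gamma$; the over-approximation is $\overline{npe}=\sum_{\Delta\cup\Gamma}p\cdot n^{i_{(p,a,b)}}j_{(p,a,b)}^n+\sum_{\Lambda\setminus(\Delta\cup\Gamma)}p\cdot n^a b^n$, and its threshold $D$ is the maximum ($\max\emptyset=0$) of the $1$-monotonicity thresholds of $(j,i)$ and $(b,a)$ over $\Delta$ and of $(b,a)$ and $(j,i)$ over $\Gamma$. It is eventually non-positive if, whenever $\overline{npe}\neq npe$, for every $\vec e\in\Psi'$ there is $m$ with $\sigma_{\vec e}(\overline{npe})\le0$ for all $n\ge m$. *)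

(* Defs.v *)
From HB Require Import structures.
From mathcomp Require Import all_boot all_order all_algebra.
From mathcomp Require Import finmap.
From mathcomp.multinomials Require Import -(notations) monalg.
From mathcomp.multinomials Require Import mpoly.
From Stdlib Require ClassicalEpsilon.

Set Implicit Arguments.
Unset Strict Implicit.
Unset Printing Implicit Defensive.

Import Order.TTheory GRing.Theory Num.Theory.

Local Open Scope ring_scope.

(* The atom (s1, s2) stands for the inequation s1 < s2. *)
Definition atom (d : nat) : Type := ({mpoly int[d]} * {mpoly int[d]})%type.

Inductive formula (d : nat) : Type :=
| FAtom of atom d
| FAnd of formula d & formula d
| FOr of formula d & formula d.

Definition state (d : nat) : Type := {ffun 'I_d -> int}.

Fixpoint sat d (s : state d) (f : formula d) : bool :=
  match f with
  | FAtom a => a.1.@[s] < a.2.@[s]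
  | FAnd f1 f2 => sat s f1 && sat s f2
  | FOr f1 f2 => sat s f1 || sat s f2
  end.

Fixpoint atoms d (f : formula d) : seq (atom d) :=
  match f with
  | FAtom a => [:: a]
  | FAnd f1 f2 => atoms f1 ++ atoms f2
  | FOr f1 f2 => atoms f1 ++ atoms f2
  end.

Definition update (d : nat) : Type := d.-tuple {mpoly int[d]}.

Fixpoint fsubst d (u : update d) (f : formula d) : formula d :=
  match f with
  | FAtom a => FAtom (a.1 \mPo u, a.2 \mPo u)
  | FAnd f1 f2 => FAnd (fsubst u f1) (fsubst u f2)
  | FOr f1 f2 => FOr (fsubst u f1) (fsubst u f2)
  end.

Record loop (d : nat) : Type := Loop {
  loop_psi : formula d;
  loop_phi : formula d;
  loop_eta : update d
}.

Definition loop_psi' d (L : loop d) : formula d := FAnd (loop_psi L) (loop_phi L).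

Definition update_invariant d (L : loop d) : Prop :=
  forall s : state d, sat s (loop_psi L) -> sat s (fsubst (loop_eta L) (loop_psi L)).

(* eta(x_i) = c_i * x_i + p_i, where p_i only contains variables x_j, j > i. *)
Definition twn_update d (c : 'I_d -> int) (u : update d) : Prop :=
  forall i : 'I_d, exists2 p : {mpoly int[d]},
    tnth u i = c i *: 'X_i + p &
    forall m, m \in msupp p -> forall j : 'I_d, (j <= i)%N -> m j = 0%N.

Definition tnn_loop d (L : loop d) : Prop :=
  update_invariant L /\
  exists2 c : 'I_d -> int, twn_update c (loop_eta L) & forall i, 0 <= c i.

Inductive loc : Type := Loc0 | Loc1.

Inductive trans : Type := T0 | T1.

Definition trans_eqb (s s' : trans) : bool :=
  match s, s' with T0, T0 | T1, T1 => true | _, _ => false end.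

Lemma trans_eqP : Equality.axiom trans_eqb.
Proof. by case; case; constructor. Qed.

HB.instance Definition _ := hasDecEq.Build trans trans_eqP.

Definition src (s : trans) : loc := if s is T0 then Loc0 else Loc1.

Definition tgt (s : trans) : loc := Loc1.

Definition guard d (L : loop d) (s : trans) : formula d :=
  if s is T0 then loop_psi L else loop_phi L.

Definition upd d (L : loop d) (s : trans) : update d :=
  if s is T0 then [tuple 'X_i | i < d] else loop_eta L.

Definition config (d : nat) : Type := (loc * state d)%type.

Definition step d (L : loop d) (s : trans) (c c' : config d) : Prop :=
  [/\ c.1 = src s, c'.1 = tgt s, sat c.2 (guard L s) &
      forall i, c'.2 i = (tnth (upd L s) i).@[c.2]].

Inductive evaluation d (L : loop d) : config d -> seq trans -> config d -> Prop :=
| EvalNil c : evaluation L c [::] c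
| EvalCons c s c' ss c'' :
    step L s c c' -> evaluation L c' ss c'' -> evaluation L c (s :: ss) c''.

(* Evaluations of an integer program start in its initial location, so that the
   states outside psi are irrelevant for termination. *)
Definition terminating d (L : loop d) : Prop :=
  ~ exists c : nat -> config d,
      (c 0%N).1 = Loc0 /\ forall k, exists s, step L s (c k) (c k.+1).

(* [BConst None] is omega. *)
Inductive bound (d : nat) : Type :=
| BConst of option nat
| BVar of 'I_d
| BAdd of bound d & bound d
| BMul of bound d & bound d
| BExp of nat & bound d.
Arguments BConst {d}.
Arguments BVar {d}.

(* Arithmetic on N + {omega}, omega being None; 0 * omega = 0, and k ^ omega is
   k for k <= 1 and omega for k >= 2. *)
Definition oadd (x y : option nat) : option nat :=
  match x, y with Some a, Some b => Some (a + b)%N | _, _ => None end.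

Definition omul (x y : option nat) : option nat :=
  match x, y with
  | Some a, Some b => Some (a * b)%N
  | Some c, None | None, Some c => if c == 0%N then Some 0%N else None
  | None, None => None
  end.

Definition oexp (k : nat) (x : option nat) : option nat :=
  match x with
  | Some a => Some (k ^ a)%N
  | None => if (k <= 1)%N then Some k else None
  end.

Definition ole (n : nat) (x : option nat) : Prop :=
  if x is Some m then (n <= m)%N else True.

Fixpoint beval d (v : 'I_d -> nat) (b : bound d) : option nat :=
  match b with
  | BConst c => c
  | BVar i => Some (v i)
  | BAdd b1 b2 => oadd (beval v b1) (beval v b2)
  | BMul b1 b2 => omul (beval v b1) (beval v b2)
  | BExp k b1 => oexp k (beval v b1)
  end.

Definition global_runtime_bound d (L : loop d) (RB : trans -> bound d) : Prop :=
  forall (s0 : state d) (s : trans) (ss : seq trans) (c : config d),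
    evaluation L (Loc0, s0) ss c ->
    ole (count_mem s ss) (beval (fun i => `|s0 i|%N) (RB s)).

Definition bound_of_monom d (m : 'X_{1..d}) : bound d :=
  foldr (fun i b => BMul (iter (m i) (BMul (BVar i)) (BConst (Some 1%N))) b)
        (BConst (Some 1%N)) (enum 'I_d).

(* A polynomial over N read as a bound. For p in Z[x] the absolute values of the
   coefficients are taken, which is the identity on the polynomials of interest;
   see [beval_bound_of_mpoly]. *)
Definition bound_of_mpoly d (p : {mpoly int[d]}) : bound d :=
  foldr (fun m b =>
           BAdd (BMul (BConst (Some `|p@_m|%N)) (bound_of_monom m)) b)
        (BConst (Some 0%N)) (msupp p).

Lemma beval_bound_of_monom d (v : 'I_d -> nat) (m : 'X_{1..d}) :
  beval v (bound_of_monom m) = Some (\prod_i v i ^ m i)%N.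
Proof.
rewrite /bound_of_monom.
have -> : (\prod_i v i ^ m i = \prod_(i <- enum 'I_d) v i ^ m i)%N by rewrite big_enum.
elim: (enum _) => [|i s IHs] /=; first by rewrite big_nil.
have powE k : beval v (iter k (BMul (BVar i)) (BConst (Some 1%N))) = Some (v i ^ k)%N.
  by elim: k => //= k ->; rewrite expnS.
by rewrite IHs powE big_cons.
Qed.

Lemma beval_bound_of_mpoly d (p : {mpoly int[d]}) (v : 'I_d -> nat) :
    (forall m, 0 <= p@_m) ->
  exists2 n : nat, beval v (bound_of_mpoly p) = Some n &
                   p.@[fun i => (v i)%:Z] = n%:Z.
Proof.
move=> p_ge0; rewrite mevalE /bound_of_mpoly.
elim: (msupp p) => [|m s [n IHs IHp]]; first by exists 0%N => //; rewrite big_nil.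
exists (`|p@_m| * \prod_i v i ^ m i + n)%N.
  by rewrite /= IHs beval_bound_of_monom.
rewrite big_cons IHp PoszD PoszM gez0_abs ?p_ge0 //; congr (_ * _ + _).
rewrite (big_morph Posz PoszM (erefl _)); apply: eq_bigr => i _.
by elim: (m i) => [|k IHk]; rewrite ?expr0 ?expn0 // exprS expnS IHk PoszM.
Qed.

(* The pair (b, a) stands for the expression n^a * b^n. These expressions form a
   monoid, and poly-exponential expressions are the elements of the monoid
   algebra over Q[x]: collected sums of terms p * n^a * b^n, p <> 0. *)
Definition expo : Type := (nat * nat)%type.
HB.instance Definition _ := Choice.on expo.

Definition expo_one : expo := (1%N, 0%N).
Definition expo_mul (x y : expo) : expo := ((x.1 * y.1)%N, (x.2 + y.2)%N).

Fact expo_mulA : associative expo_mul.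
Proof. by move=> x y z; rewrite /expo_mul mulnA addnA. Qed.
Fact expo_mulC : commutative expo_mul.
Proof. by move=> x y; rewrite /expo_mul mulnC addnC. Qed.
Fact expo_mul1 : left_id expo_one expo_mul.
Proof. by case=> b a; rewrite /expo_mul /= mul1n add0n. Qed.
Fact expo_mulr1 : right_id expo_one expo_mul.
Proof. by case=> b a; rewrite /expo_mul /= muln1 addn0. Qed.
Fact expo_unit (x y : expo) :
  expo_mul x y = expo_one -> x = expo_one /\ y = expo_one.
Proof.
case: x y => [b a] [b' a'] [] /eqP; rewrite muln_eq1 => /andP[/eqP-> /eqP->].
by move=> /eqP; rewrite addn_eq0 => /andP[/eqP-> /eqP->].
Qed.

HB.instance Definition _ := Choice_isMonomialDef.Build expo
  expo_mulA expo_mul1 expo_mulr1 expo_unit.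
HB.instance Definition _ := MonomialDef_isConomialDef.Build expo expo_mulC.

Definition pexpr (d : nat) : Type := monalg.malg expo {mpoly rat[d]}.

Definition pecoeff d (k : expo) (e : pexpr d) : {mpoly rat[d]} := monalg.mcoeff k e.
Definition pesupp d (e : pexpr d) : {fset expo} := monalg.msupp e.

Definition peterm d (p : {mpoly rat[d]}) (k : expo) : pexpr d := monalg.mkmalgU k p.

Definition ratpoint d (s : state d) (i : 'I_d) : rat := (s i)%:~R.

Definition peval d (e : pexpr d) (s : state d) (n : nat) : rat :=
  \sum_(k <- pesupp e) (pecoeff k e).@[ratpoint s] * n%:R ^+ k.2 * k.1%:R ^+ n.

Definition normalized d (e : pexpr d) : Prop :=
  forall k, k \in pesupp e -> (1 <= k.1)%N.

Definition closed_form d (u : update d) (X : d.-tuple (pexpr d)) (n0 : nat) : Prop :=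
  forall (i : 'I_d) (s : state d) (n : nat), (n0 <= n)%N ->
    peval (tnth X i) s n = ((iter n (comp_mpoly u) 'X_i).@[s])%:~R.

(* q[x / X] *)
Definition pesubst d (X : d.-tuple (pexpr d)) (q : {mpoly int[d]}) : pexpr d :=
  mmap (fun z : int => z%:~R : pexpr d) (tnth X) q.

Definition denom_lcm d (e : pexpr d) : nat :=
  \big[lcmn/1%N]_(k <- pesupp e) \big[lcmn/1%N]_(m <- msupp (pecoeff k e))
    `|denq ((pecoeff k e)@_m)|%N.

Definition npe d (X : d.-tuple (pexpr d)) (a : atom d) : pexpr d :=
  let e := pesubst X (a.2 - a.1) in e *+ denom_lcm e.

Definition lexgt (x y : expo) : bool :=
  (y.1 < x.1)%N || (x.1 == y.1) && (y.2 < x.2)%N.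

Definition is_mon_threshold (k : nat) (x y : expo) (n0 : nat) : Prop :=
  let dom m := forall n, (m <= n)%N -> (k * (n ^ y.2 * y.1 ^ n) < n ^ x.2 * x.1 ^ n)%N in
  dom n0 /\ forall m, dom m -> (n0 <= m)%N.

(* The smallest such number; unspecified if there is none, which for x > y in the
   lexicographic order only happens if both bases are 0. *)
Definition mon_threshold (k : nat) (x y : expo) : nat :=
  ClassicalEpsilon.epsilon (inhabits 0%N) (is_mon_threshold k x y).

(* The index (m, (b, a)) of a summand (c * x^m) * n^a * b^n. *)
Definition tindex (d : nat) : Type := ('X_{1..d} * expo)%type.

(* The set Lambda of the terms (p, a, b) of the fully expanded e. A term is given
   by its index t, and p is then [tmonom e t]; distinct terms have distinct
   indices. *)
Definition terms d (e : pexpr d) : seq (tindex d) :=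
  [seq (m, k) | k <- pesupp e, m <- msupp (pecoeff k e)].

Definition tmonom d (e : pexpr d) (t : tindex d) : {mpoly rat[d]} :=
  (pecoeff t.2 e)@_t.1 *: 'X_[t.1].

Record overapprox (d : nat) : Type := OverApprox {
  oa_Delta : {fset tindex d};
  oa_Gamma : {fset tindex d};
  oa_i : tindex d -> nat;
  oa_j : tindex d -> nat
}.

Definition oa_expo d (o : overapprox d) (t : tindex d) : expo := (oa_j o t, oa_i o t).

Definition valid_overapprox d (f : formula d) (e : pexpr d) (o : overapprox d) : Prop :=
  [/\ {subset oa_Delta o <= terms e}, {subset oa_Gamma o <= terms e},
      [disjoint oa_Delta o & oa_Gamma o]%fset,
      forall t, t \in oa_Delta o ->
        (forall s : state d, sat s f -> 0 < (tmonom e t).@[ratpoint s]) /\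
        lexgt (oa_expo o t) t.2 &
      forall t, t \in oa_Gamma o ->
        (forall s : state d, sat s f -> (tmonom e t).@[ratpoint s] <= 0) /\
        lexgt t.2 (oa_expo o t)].

Definition oa_expr d (e : pexpr d) (o : overapprox d) : pexpr d :=
  \sum_(t <- terms e | t \in (oa_Delta o `|` oa_Gamma o)%fset)
     peterm (tmonom e t) (oa_expo o t) +
  \sum_(t <- terms e | t \notin (oa_Delta o `|` oa_Gamma o)%fset)
     peterm (tmonom e t) t.2.

Definition oa_threshold d (o : overapprox d) : nat :=
  maxn (\max_(t <- oa_Delta o) mon_threshold 1 (oa_expo o t) t.2)%N
       (\max_(t <- oa_Gamma o) mon_threshold 1 t.2 (oa_expo o t))%N.

Definition eventually_nonpos d (f : formula d) (e : pexpr d) (o : overapprox d) : Prop :=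
  oa_expr e o <> e ->
  forall s : state d, sat s f ->
    exists m, forall n, (m <= n)%N -> peval (oa_expr e o) s n <= 0.

(* (b_1, a_1), ..., (b_l, a_l) in increasing lexicographic order. *)
Definition pe_expos d (e : pexpr d) : seq expo :=
  sort (fun x y => (x == y) || lexgt y x) (pesupp e).

Section CThreshold.
Variables (d : nat) (e : pexpr d).

Let ba (j : nat) : expo := nth expo_one (pe_expos e) j.-1.

Definition M_threshold (j : nat) : nat :=
  if (ba j).1 == (ba j.-1).1 then 0%N
  else mon_threshold 1 (ba j) ((ba j.-1).1, (ba j.-1).2.+1).

Definition N_threshold (j : nat) : nat :=
  let mt' := mon_threshold (j - 2) (ba (j - 1)) (ba (j - 2)) in
  let mt := (\max_(1 <= i < (j - 3).+1) mon_threshold 1 (ba (j - 2)) (ba i))%N in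
  if j == 2 then 1%N else if j == 3 then mt' else maxn mt mt'.

Definition C_threshold : nat :=
  maxn 1 (\max_(2 <= j < (size (pe_expos e)).+1) maxn (N_threshold j) (M_threshold j))%N.

(* {p_1, ..., p_(l-1)} *)
Definition lower_polys : seq {mpoly rat[d]} :=
  [seq pecoeff k e | k <- take (size (pe_expos e)).-1 (pe_expos e)].

End CThreshold.

(* Sup of a finite set of polynomials: coefficientwise maximal absolute value. *)
Definition sqcup d (Q : seq {mpoly rat[d]}) : {mpoly rat[d]} :=
  \sum_(m <- undup (flatten [seq (msupp q : seq 'X_{1..d}) | q <- Q]))
    (\big[Num.max/0]_(q <- Q) `|q@_m|) *: 'X_[m].

Section SthSup.
Variables (d : nat) (L : loop d) (X : d.-tuple (pexpr d)) (n0 : nat).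
Variable oa : atom d -> overapprox d.

Let approx (a : atom d) : pexpr d := oa_expr (npe X a) (oa a).

Definition Pol : seq {mpoly rat[d]} :=
  flatten [seq lower_polys (approx a) | a <- atoms (loop_phi L)].

Definition C_max : nat := (\max_(a <- atoms (loop_phi L)) C_threshold (approx a))%N.

Definition D_max : nat := (\max_(a <- atoms (loop_phi L)) oa_threshold (oa a))%N.

Definition sth_sqcup : {mpoly rat[d]} :=
  2%:R * sqcup Pol + (maxn n0 (maxn C_max D_max))%:R.

End SthSup.

Definition is_sth d (L : loop d) (s : state d) (m : nat) : Prop :=
  let stable m' := forall n, (m' <= n)%N ->
    sat s (iter n (fsubst (loop_eta L)) (loop_phi L)) =
    sat s (iter m' (fsubst (loop_eta L)) (loop_phi L)) in
  stable m /\ forall m', stable m' -> (m <= m')%N.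

Definition RB_glo d (S : {mpoly int[d]}) (s : trans) : bound d :=
  if s is T0 then BConst (Some 1%N) else bound_of_mpoly S.

(* Main.v *)
Require Import Defs.
From HB Require Import structures.
From mathcomp Require Import all_boot all_order all_algebra.
From mathcomp Require Import finmap.
From mathcomp.multinomials Require Import -(notations) monalg.
From mathcomp.multinomials Require Import mpoly.
From mathcomp Require Import zify ring lra.
From Stdlib Require Classical ClassicalEpsilon.

Set Implicit Arguments.
Unset Strict Implicit.
Unset Printing Implicit Defensive.

Import Order.TTheory GRing.Theory Num.Theory.

Local Open Scope ring_scope.

(* Along the flow of the loop, the atom s1 < s2 holds after n >= n0 iterations iff
   npe is positive at n. Beyond C, the summand with index m of a poly-exponential
   expression is at least n times the previous one, which in turn exceeds the sum of all
   earlier ones; hence once n is also at least twice the absolute values of the lower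
   coefficients, the sign is that of the last summand whose coefficient does not
   vanish, and no longer changes. An over-approximation other than npe is eventually
   non-positive, hence non-positive from then on, and beyond D it bounds npe from
   above, so that the atom is false. Thus the truth value of phi is constant from the
   bound on; if the loop were still running there, it would run forever.

   Bases equal to 0 may occur in an over-approximation. The corresponding
   monotonicity thresholds need not exist, but the summands then vanish for all
   n >= 1, so the junk values can only enlarge the bound. *)

(** * Growth of the expressions n^a * b^n and their monotonicity thresholds *)

Lemma ex_min_nat (P : nat -> Prop) (n : nat) :
  P n -> exists2 m, P m & forall k, P k -> (m <= k)%N.
Proof.
elim/ltn_ind: n => n IHn Pn.
case: (Classical_Prop.classic (exists2 k, P k & (k < n)%N)) => [[k Pk ltkn]|no].
  exact: IHn ltkn Pk.
exists n => // k Pk; rewrite leqNgt; apply/negP => ltkn.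
by apply: no; exists k.
Qed.

Definition pe_mon (k : expo) (n : nat) : nat := (n ^ k.2 * k.1 ^ n)%N.

Lemma pe_mon_gt0 (k : expo) (n : nat) :
  (0 < k.1)%N -> (0 < n)%N -> (0 < pe_mon k n)%N.
Proof. by move=> k_gt0 n_gt0; rewrite muln_gt0 !expn_gt0 k_gt0 n_gt0. Qed.

Lemma pe_mon0 (k : expo) (n : nat) : k.1 = 0%N -> (0 < n)%N -> pe_mon k n = 0%N.
Proof. by move=> k0 n_gt0; rewrite /pe_mon k0 exp0n ?muln0. Qed.

(** The k factors m + k, ..., m + 1 of the falling factorial are all at least m. *)
Lemma expn_leq_ffact (m k : nat) : (m ^ k <= (m + k) ^_ k)%N.
Proof.
elim: k => [|k IHk]; first by rewrite ffactn0.
by rewrite expnS addnS ffactSS leq_mul // leqW ?leq_addr.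
Qed.

(** The binomial expansion of (b + 1)^n contains the summand 'C(n, a + 1) * b^(n - a - 1), which up
    to a constant factor grows like n^(a + 1) * b^n. *)
Lemma expn_dominates (c a b : nat) : (0 < b)%N ->
  exists N, forall n, (N <= n)%N -> (c * (n ^ a * b ^ n) < b.+1 ^ n)%N.
Proof.
move=> b_gt0; pose F := (a.+1)`!.
(* For m = n - (a + 1) this yields n <= 2 * m and m > c * 2^a * b^(a + 1) * (a + 1)!. The constant
   pays for n^a <= (2 * m)^a, for b^n = b^(a + 1) * b^m and for the denominator of the binomial
   coefficient. *)
exists (a.+1 + a.+1 + (c * 2 ^ a * b ^ a.+1 * F).+1)%N => n leNn.
have [m def_n]: exists m, n = (m + a.+1)%N by exists (n - a.+1)%N; lia.
have lt_m : (c * 2 ^ a * b ^ a.+1 * F < m)%N by lia.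
have binD : ('C(n, a.+1) * b ^ m <= b.+1 ^ n)%N.
  have a_n : (a.+1 < n.+1)%N by lia.
  have -> : m = (n - a.+1)%N by lia.
  rewrite -[b.+1]addn1 expnDn (bigD1 (Ordinal a_n)) //= exp1n muln1.
  by rewrite leq_addr.
rewrite -(@ltn_pmul2r F) ?fact_gt0 //.
apply: (@leq_trans ('C(n, a.+1) * b ^ m * F)%N); last first.
  by rewrite leq_mul2r binD orbT.
rewrite [leqRHS]mulnAC /F bin_ffact.
apply: (@leq_trans (m ^ a.+1 * b ^ m)); last first.
  by rewrite leq_mul2r def_n expn_leq_ffact orbT.
have le_nm : (n <= 2 * m)%N by lia.
have le_n2m : (n ^ a <= 2 ^ a * m ^ a)%N.
  by rewrite -expnMn; case: (a) => // a'; rewrite leq_exp2r.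
have m_gt0 : (0 < m)%N by lia.
have ->: (b ^ n = b ^ a.+1 * b ^ m)%N by rewrite def_n addnC expnD.
apply: (@leq_ltn_trans (c * 2 ^ a * b ^ a.+1 * F * (m ^ a * b ^ m))%N); last first.
  by rewrite (expnS m) -[X in (_ < X)%N]mulnA ltn_pmul2r // muln_gt0 !expn_gt0
             b_gt0 m_gt0.
rewrite -/F [leqLHS](_ : _ = (c * b ^ a.+1 * b ^ m * F) * n ^ a)%N; last by ring.
rewrite [leqRHS](_ : _ = (c * b ^ a.+1 * b ^ m * F) * (2 ^ a * m ^ a))%N; last by ring.
by rewrite leq_mul2l le_n2m orbT.
Qed.

(** The value chosen by [epsilon] is meaningful only if a threshold exists, so it suffices to find
    some bound N beyond which the inequality holds. If the bases differ, b >= b' + 1 and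
    [expn_dominates] applies. *)
Lemma mon_thresholdP (c : nat) (x y : expo) : (0 < x.1)%N -> lexgt x y ->
  forall n, (mon_threshold c x y <= n)%N -> (c * pe_mon y n < pe_mon x n)%N.
Proof.
case: x y => [b a] [b' a'] /= b_gt0 gt_xy.
suff [N domN]: exists N, forall n, (N <= n)%N ->
    (c * (n ^ a' * b' ^ n) < n ^ a * b ^ n)%N.
  have [m m_dom m_min] := @ex_min_nat (fun m => forall n, (m <= n)%N ->
    (c * (n ^ a' * b' ^ n) < n ^ a * b ^ n)%N) N domN.
  have exm : exists m, is_mon_threshold c (b, a) (b', a') m by exists m.
  by case: (ClassicalEpsilon.epsilon_spec (inhabits 0%N) _ exm).
case/orP: gt_xy => /= [lt_b | /andP[/eqP eq_b lt_a]].
  case: (posnP b') => [-> | b'_gt0].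
    by exists 1%N => n n_gt0; rewrite exp0n ?muln0 // muln_gt0 !expn_gt0 b_gt0 n_gt0.
  have [N domN] := expn_dominates c a' b'_gt0.
  exists N.+1 => n ltNn; apply: (leq_trans (domN n (ltnW ltNn))).
  apply: (@leq_trans (b ^ n)); first by rewrite leq_exp2r //; lia.
  by rewrite leq_pmull // expn_gt0; lia.
(* For equal bases, n > c gives n^a >= n * n^a' > c * n^a'. *)
rewrite eq_b in b_gt0 *; exists c.+1 => n lt_cn.
apply: (@leq_trans (n ^ a'.+1 * b' ^ n)).
  by rewrite expnS -[X in (_ < X)%N]mulnA ltn_pmul2r // muln_gt0 !expn_gt0; lia.
by rewrite leq_mul2r leq_pexp2l ?orbT //; lia.
Qed.

(** If the larger base is 0, so is the other one; both sides then vanish, and the weak inequality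
    holds whatever value the threshold has. *)
Lemma pe_mon_leq (x y : expo) (n : nat) : lexgt x y -> (0 < n)%N ->
  (mon_threshold 1 x y <= n)%N -> (pe_mon y n <= pe_mon x n)%N.
Proof.
move=> gt_xy n_gt0 le_n; case: (posnP x.1) => [x0 | x_gt0]; last first.
  by rewrite ltnW // -[pe_mon y n]mul1n mon_thresholdP.
have y0 : y.1 = 0%N by case/orP: gt_xy => [|/andP[/eqP<- _] //]; rewrite x0.
by rewrite !pe_mon0.
Qed.

Lemma lexgt_trans : transitive lexgt.
Proof. by move=> y x z; rewrite /lexgt; lia. Qed.

(** The order given to [sort] is reflexive; strictness comes from the absence of duplicates in the
    support. *)
Lemma pe_expos_sorted d (e : pexpr d) : sorted (fun x y => lexgt y x) (pe_expos e).
Proof.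
set r := fun x y : expo => (x == y) || lexgt y x.
have r_total : total r.
  move=> [b a] [b' a']; rewrite /r /lexgt /= !xpair_eqE; lia.
have r_trans : transitive r.
  by move=> [b a] [b' a'] [b'' a'']; rewrite /r /lexgt /= !xpair_eqE; lia.
have uniq_e : uniq (pe_expos e) by rewrite sort_uniq fset_uniq.
have : sorted r (pe_expos e) by apply: sort_sorted.
rewrite !sorted_pairwise //; last by move=> y x z /= xy yz; exact: lexgt_trans yz xy.
move: uniq_e; rewrite uniq_pairwise.
move=> /pairwiseP-/(_ expo_one) neq_e /pairwiseP-/(_ expo_one) le_e.
apply/(pairwiseP expo_one) => i j i_lt j_lt ij.
have /= /negPf neq_ij := neq_e i j i_lt j_lt ij.
by have := le_e i j i_lt j_lt ij; rewrite /r neq_ij.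
Qed.

(** * Dominance of a summand over the earlier ones beyond C *)

Section Dominance.
Variables (d : nat) (e : pexpr d).
Let l := size (pe_expos e).
Let ba (i : nat) : expo := nth expo_one (pe_expos e) i.

Lemma pe_expos_lexgt (i j : nat) : (i < j < l)%N -> lexgt (ba j) (ba i).
Proof.
move=> /andP[ij jl]; have /= s := pe_expos_sorted e.
have gt_trans : transitive (fun x y => lexgt y x).
  by move=> y x z xy yz; exact: lexgt_trans yz xy.
by apply: (sorted_ltn_nth gt_trans expo_one s); rewrite ?inE // (ltn_trans ij).
Qed.

Lemma pe_expos_base (i j : nat) : (i <= j < l)%N -> ((ba i).1 <= (ba j).1)%N.
Proof.
move=> /andP[]; rewrite leq_eqVlt => /predU1P[-> // | ij jl].
have ijl : (i < j < l)%N by rewrite ij.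
by have /orP[/ltnW // | /andP[/eqP-> _]] := pe_expos_lexgt ijl.
Qed.

Lemma C_threshold_gt0 : (0 < C_threshold e)%N.
Proof. by rewrite leq_max. Qed.

Lemma N_threshold_le (m : nat) : (0 < m < l)%N -> (N_threshold e m.+1 <= C_threshold e)%N.
Proof.
move=> ml; rewrite leq_max; apply/orP; right.
apply: leq_trans (leq_maxl _ (M_threshold e m.+1)) _.
apply: (leq_bigmax_seq _ (F := fun j => maxn (N_threshold e j) (M_threshold e j))) => //.
by rewrite mem_index_iota; lia.
Qed.

Lemma M_threshold_le (m : nat) : (0 < m < l)%N -> (M_threshold e m.+1 <= C_threshold e)%N.
Proof.
move=> ml; rewrite leq_max; apply/orP; right.
apply: leq_trans (leq_maxr (N_threshold e m.+1) _) _.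
apply: (leq_bigmax_seq _ (F := fun j => maxn (N_threshold e j) (M_threshold e j))) => //.
by rewrite mem_index_iota; lia.
Qed.

(** Beyond mt no earlier summand exceeds the one just before the last, and beyond mt' the last one
    exceeds that one times the number of summands before it. *)
Lemma sum_pe_mon_lt (m n : nat) : (m.+1 < l)%N -> (0 < (ba m).1)%N ->
  (C_threshold e <= n)%N -> (\sum_(i < m) pe_mon (ba i) n < pe_mon (ba m) n)%N.
Proof.
move=> ml bm le_n; have n_gt0 : (0 < n)%N := leq_trans C_threshold_gt0 le_n.
case: m ml bm => [|m] ml bm; first by rewrite big_ord0 pe_mon_gt0.
(* Here [ba] counts from 0 and the thresholds count from 1: N with index m + 3 compares the
   exponents m + 1 and m, and it contributes to C only if m + 2 < l. *)
have Nle := leq_trans (@N_threshold_le m.+2 ml) le_n.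
have lt_m : (m.+1 * pe_mon (ba m) n < pe_mon (ba m.+1) n)%N.
  apply: mon_thresholdP => //; first by apply: pe_expos_lexgt; lia.
  move: Nle; rewrite /N_threshold /= !subSS !subn0; case: ifP => // _.
  by rewrite geq_max => /andP[].
apply: leq_ltn_trans lt_m; rewrite -[X in (_ <= X * _)%N]card_ord -sum_nat_const.
apply: leq_sum => i _; have := ltn_ord i; rewrite ltnS leq_eqVlt => /predU1P[-> //|lt_im].
apply: pe_mon_leq => //; first by apply: pe_expos_lexgt; lia.
move: Nle; rewrite /N_threshold /= !subSS !subn0; case: ifP => [/eqP[m0]|_].
  by move: lt_im; rewrite [X in (_ < X)%N]m0.
rewrite geq_max => /andP[+ _]; apply: leq_trans.
apply: (leq_bigmax_seq i.+1 (F := fun j => mon_threshold 1 (ba m) (ba j.-1))) => //.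
by rewrite mem_index_iota; lia.
Qed.

(** The extra factor n raises the exponent of n by one. For equal bases the next exponent is already
    that large; otherwise M is the threshold for exactly this comparison. *)
Lemma pe_mon_step (m n : nat) : (m.+1 < l)%N -> (0 < (ba m.+1).1)%N ->
  (C_threshold e <= n)%N -> (n * pe_mon (ba m) n <= pe_mon (ba m.+1) n)%N.
Proof.
move=> ml bm le_n; have n_gt0 : (0 < n)%N := leq_trans C_threshold_gt0 le_n.
have gt_m : lexgt (ba m.+1) (ba m) by apply: pe_expos_lexgt; lia.
have := leq_trans (@M_threshold_le m.+1 ml) le_n.
rewrite /pe_mon mulnA -expnS /M_threshold /= -/(ba m) -/(ba m.+1).
case: eqP gt_m => [eq_b | neq_b] gt_m.
  move=> _; rewrite eq_b leq_mul2r leq_pexp2l ?orbT //.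
  by move: gt_m; rewrite /lexgt eq_b eqxx ltnn.
move=> /(pe_mon_leq _ n_gt0); apply; rewrite /lexgt /=.
by move: gt_m; rewrite /lexgt; case: eqP => // _; rewrite orbF => ->.
Qed.

(* The summands below f_(m-1) add up to less than f_(m-1), and the factor 2 pays for
   them: sum p_i f_i <= n/2 * sum f_i < n * f_(m-1) <= f_m. *)
Lemma leading_term_dominates (p : nat -> nat) (m n : nat) :
    (m < l)%N -> (0 < (ba m).1)%N -> (C_threshold e <= n)%N ->
    (forall i, (i < m)%N -> (2 * p i <= n)%N) ->
  (\sum_(i < m) p i * pe_mon (ba i) n < pe_mon (ba m) n)%N.
Proof.
move=> ml bm le_n le_p; have n_gt0 : (0 < n)%N := leq_trans C_threshold_gt0 le_n.
case: m ml bm le_p => [|m] ml bm le_p; first by rewrite big_ord0 pe_mon_gt0.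
(* If the base just below the top is 0, all earlier bases are 0 as well and the left-hand sum
   vanishes. *)
case: (posnP (ba m).1) => [b0 | b_gt0].
  rewrite big1 ?pe_mon_gt0 // => i _; rewrite pe_mon0 ?muln0 //; apply/eqP.
  by rewrite -leqn0 -b0; apply: pe_expos_base; have := ltn_ord i; lia.
rewrite -(@ltn_pmul2l 2) // big_distrr /=.
apply: (@leq_ltn_trans (n * \sum_(i < m.+1) pe_mon (ba i) n)%N).
  by rewrite big_distrr leq_sum // => i _; rewrite mulnA leq_mul2r le_p ?orbT.
have lt_sum := sum_pe_mon_lt ml b_gt0 le_n.
have le_step := pe_mon_step ml bm le_n.
apply: (@leq_trans (2 * (n * pe_mon (ba m) n))); last by rewrite leq_mul2l.
by rewrite big_ord_recr /= mulnCA ltn_pmul2l // mul2n -addnn ltn_add2r.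
Qed.

End Dominance.

(** * Iteration of the update and evaluation of closed forms *)

Definition flow d (u : update d) (s : state d) : state d :=
  [ffun i => (tnth u i).@[s]].

Lemma meval_flow d (u : update d) (s : state d) (q : {mpoly int[d]}) :
  (q \mPo u).@[s] = q.@[flow u s].
Proof. by rewrite comp_mpoly_meval; apply: meval_eq => i; rewrite ffunE. Qed.

Lemma meval_iter_flow d (u : update d) (s : state d) (q : {mpoly int[d]}) (n : nat) :
  (iter n (comp_mpoly u) q).@[s] = q.@[iter n (flow u) s].
Proof. by elim: n s => //= n IHn s; rewrite meval_flow IHn -iterS iterSr. Qed.

Lemma sat_fsubst d (u : update d) (f : formula d) (s : state d) :
  sat s (fsubst u f) = sat (flow u s) f.
Proof. by elim: f => [a | f IHf g IHg | f IHf g IHg] /=; rewrite ?meval_flow ?IHf ?IHg. Qed.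

Lemma sat_iter_fsubst d (u : update d) (f : formula d) (s : state d) (n : nat) :
  sat s (iter n (fsubst u) f) = sat (iter n (flow u) s) f.
Proof. by elim: n s => //= n IHn s; rewrite sat_fsubst IHn -iterS iterSr. Qed.

Definition pe_monr (n : nat) (k : expo) : rat := (pe_mon k n)%:R.

(** Makes evaluation at a fixed n a ring morphism on the monoid algebra, hence compatible with
    substituting the closed form into a polynomial. *)
Fact pe_monr_mmorphism (n : nat) : mmorphism (pe_monr n).
Proof.
have pe_mon1 : pe_mon expo_one n = 1%N by rewrite /pe_mon exp1n.
have pe_monM x y : pe_mon (expo_mul x y) n = (pe_mon x n * pe_mon y n)%N.
  by rewrite /pe_mon /= expnD expnMn mulnACA.
split=> [x y|]; last exact: (congr1 (fun z => z%:R) pe_mon1).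
by rewrite /pe_monr -natrM; exact: (congr1 (fun z => z%:R) (pe_monM x y)).
Qed.
HB.instance Definition _ (n : nat) :=
  monalg.isMultiplicative.Build expo rat (pe_monr n) (pe_monr_mmorphism n).

Lemma pevalE d (s : state d) (n : nat) (e : pexpr d) :
  peval e s n = monalg.mmap (meval (ratpoint s)) (pe_monr n) e.
Proof.
rewrite monalg.mmapE; apply: eq_bigr => k _.
by rewrite /pe_monr natrM !natrX mulrA.
Qed.

Lemma peval_term d (s : state d) (n : nat) (p : {mpoly rat[d]}) (k : expo) :
  peval (peterm p k) s n = p.@[ratpoint s] * (pe_mon k n)%:R.
Proof. by rewrite pevalE monalg.mmapU. Qed.

Lemma peval_pesubst d (u : update d) (X : d.-tuple (pexpr d)) (n0 n : nat)
    (s : state d) (q : {mpoly int[d]}) :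
    closed_form u X n0 -> (n0 <= n)%N ->
  peval (pesubst X q) s n = (q.@[iter n (flow u) s])%:~R.
Proof.
move=> closedX le_n; rewrite pevalE /pesubst /mmap raddf_sum mevalE raddf_sum /=.
apply: eq_bigr => m _; rewrite rmorphM rmorph_int rmorphM /=; congr (_ * _).
rewrite /mmap1 !rmorph_prod; apply: eq_bigr => i _.
by rewrite !rmorphXn /= -pevalE closedX // meval_iter_flow mevalXU.
Qed.

(** * Clearing denominators *)

Lemma denom_lcm_gt0 d (e : pexpr d) : (0 < denom_lcm e)%N.
Proof.
rewrite /denom_lcm.
elim/big_ind: _ => // [x y x0 y0 | k _]; first by rewrite lcmn_gt0 x0.
elim/big_ind: _ => // [x y x0 y0 | m _]; first by rewrite lcmn_gt0 x0.
by rewrite absz_gt0 denq_neq0.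
Qed.

Lemma denq_dvd_denom_lcm d (e : pexpr d) (k : expo) (m : 'X_{1..d}) :
  (`|denq ((pecoeff k e)@_m)| %| denom_lcm e)%N.
Proof.
have [km | /memN_msupp_eq0-> ] := boolP (m \in msupp (pecoeff k e)); last first.
  exact: dvd1n.
have ke : k \in pesupp e.
  apply: contraLR km => /monalg.mcoeff_outdom; rewrite /pecoeff => ->.
  by rewrite msupp0.
rewrite /denom_lcm (big_rem k) //=; apply: dvdn_trans (dvdn_lcml _ _).
by rewrite (big_rem m) //= dvdn_lcml.
Qed.

Lemma npe_gt0 d (u : update d) (X : d.-tuple (pexpr d)) (n0 n : nat)
    (s : state d) (a : atom d) :
    closed_form u X n0 -> (n0 <= n)%N ->
  (0 < peval (npe X a) s n) = (a.1.@[iter n (flow u) s] < a.2.@[iter n (flow u) s]).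
Proof.
move=> closedX le_n; rewrite pevalE raddfMn /= -pevalE (peval_pesubst _ _ closedX) //.
by rewrite pmulrn_lgt0 ?denom_lcm_gt0 // ltr0z mevalB subr_gt0.
Qed.

(** Integrality is what bounds a nonvanishing leading coefficient away from 0: at an integer point
    its absolute value is at least 1. *)
Definition integral_coeffs d (e : pexpr d) : Prop :=
  forall k m, (pecoeff k e)@_m \is a Num.int.

Lemma npe_integral d (X : d.-tuple (pexpr d)) (a : atom d) : integral_coeffs (npe X a).
Proof.
move=> k m; rewrite /npe; set e := pesubst X _.
have -> : (pecoeff k (e *+ denom_lcm e))@_m = (pecoeff k e)@_m *+ denom_lcm e.
  by rewrite /pecoeff raddfMn /= mcoeffMn.
have /dvdnP[q ->] := denq_dvd_denom_lcm e k m; set c := (_)@_m.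
rewrite mulnC mulrnA rpredMn // -mulr_natr -[c in c * _]divq_num_den.
rewrite (_ : `|denq c|%:R = (denq c)%:~R :> rat); last first.
  by rewrite natr_absz ger0_norm ?denq_ge0.
by rewrite mulfVK ?intr_eq0 ?denq_neq0 // intr_int.
Qed.

Lemma oa_expr_integral d (e : pexpr d) (o : overapprox d) :
  integral_coeffs e -> integral_coeffs (oa_expr e o).
Proof.
move=> int_e.
have int_term t k k' m : (pecoeff k (peterm (tmonom e t) k'))@_m \is a Num.int.
  rewrite /pecoeff /peterm monalg.mcoeffU mcoeffMn rpredMn // mcoeffZ.
  by apply: rpredM; rewrite ?int_e ?mcoeffX ?rpred_nat.
move=> k m; rewrite /pecoeff /oa_expr raddfD !raddf_sum /= mcoeffD !raddf_sum /=.
by rewrite rpredD //; apply: rpred_sum => t _; apply: int_term.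
Qed.

(** * Over-approximations as upper bounds *)

Lemma peval_terms d (e : pexpr d) (s : state d) (n : nat) :
  peval e s n =
  \sum_(t <- terms e) (tmonom e t).@[ratpoint s] * (pe_mon t.2 n)%:R.
Proof.
rewrite big_allpairs_dep; apply: eq_bigr => k _ /=.
by rewrite -mulrA natrM !natrX -mulr_suml -raddf_sum -mpolyE.
Qed.

(** Replaced terms may merge or cancel in the collected expression; additivity of evaluation still
    allows a comparison with [e] term by term. *)
Lemma peval_oa_expr d (e : pexpr d) (o : overapprox d) (s : state d) (n : nat) :
  peval (oa_expr e o) s n =
  \sum_(t <- terms e) (tmonom e t).@[ratpoint s] *
    (pe_mon (if t \in (oa_Delta o `|` oa_Gamma o)%fset then oa_expo o t else t.2)
            n)%:R.
Proof.
rewrite [RHS](bigID (fun t => t \in (oa_Delta o `|` oa_Gamma o)%fset)) /=.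
rewrite pevalE raddfD !raddf_sum /=; congr (_ + _); apply: eq_bigr => t.
  by move=> ->; rewrite -pevalE peval_term.
by move=> /negPf->; rewrite -pevalE peval_term.
Qed.

(** On Delta a positive coefficient gets a larger factor, on Gamma a nonpositive coefficient gets a
    smaller one; either change can only increase the term. *)
Lemma peval_oa_expr_ge d (f : formula d) (e : pexpr d) (o : overapprox d)
    (s : state d) (n : nat) :
    valid_overapprox f e o -> sat s f -> (0 < n)%N -> (oa_threshold o <= n)%N ->
  peval e s n <= peval (oa_expr e o) s n.
Proof.
case=> _ _ _ validD validG sat_s n_gt0; rewrite geq_max => /andP[le_D le_G].
rewrite peval_terms peval_oa_expr; apply: ler_sum => t _; rewrite inE.
case: (boolP (t \in oa_Delta o)) => [tD | _] /=.
  have [/(_ s sat_s) p_gt0 gt_t] := validD t tD.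
  rewrite ler_pM2l // ler_nat; apply: pe_mon_leq => //; apply: leq_trans le_D.
  exact: (leq_bigmax_seq t (F := fun t => mon_threshold 1 (oa_expo o t) t.2)).
case: (boolP (t \in oa_Gamma o)) => [tG | _] //=.
have [/(_ s sat_s) p_le0 gt_t] := validG t tG.
rewrite ler_wnM2l // ler_nat; apply: pe_mon_leq => //; apply: leq_trans le_G.
exact: (leq_bigmax_seq t (F := fun t => mon_threshold 1 t.2 (oa_expo o t))).
Qed.

(** * Coefficientwise suprema and integral polynomials *)

Lemma mcoeff_sum_scaleX d (R : nzRingType) (r : seq 'X_{1..d}) (c : 'X_{1..d} -> R)
    (m : 'X_{1..d}) :
  uniq r -> (\sum_(m' <- r) c m' *: 'X_[m'])@_m = if m \in r then c m else 0.
Proof.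
move=> uniq_r; rewrite raddf_sum /=.
under eq_bigr => m' _ do rewrite mcoeffZ mcoeffX.
case: ifPn => [m_r | m_r].
  rewrite (bigD1_seq m) //= eqxx mulr1 big1 ?addr0 // => m' /negPf->.
  by rewrite mulr0.
rewrite big1_seq // => m' /andP[_ m'_r]; case: eqP => [eq_m | _]; last by rewrite mulr0.
by rewrite -eq_m m'_r in m_r.
Qed.

Lemma mcoeff_sqcup d (Q : seq {mpoly rat[d]}) (m : 'X_{1..d}) :
  (sqcup Q)@_m = \big[Num.max/0]_(q <- Q) `|q@_m|.
Proof.
rewrite mcoeff_sum_scaleX ?undup_uniq // mem_undup; case: ifPn => // m_Q.
apply/esym; elim: Q m_Q => [|q Q IHQ]; first by rewrite big_nil.
rewrite /= mem_cat negb_or big_cons => /andP[/memN_msupp_eq0-> /IHQ->].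
by rewrite normr0 maxxx.
Qed.

Lemma mcoeff_sqcup_ge0 d (Q : seq {mpoly rat[d]}) (m : 'X_{1..d}) :
  0 <= (sqcup Q)@_m.
Proof.
rewrite mcoeff_sqcup; elim/big_ind: _ => // x y x_ge0 y_ge0.
by rewrite le_max x_ge0.
Qed.

Lemma mcoeff_le_sqcup d (Q : seq {mpoly rat[d]}) (q : {mpoly rat[d]}) (m : 'X_{1..d}) :
  q \in Q -> `|q@_m| <= (sqcup Q)@_m.
Proof.
rewrite mcoeff_sqcup; elim: Q => // q' Q IHQ; rewrite inE big_cons le_max.
by case/predU1P => [-> | /IHQ->]; rewrite ?lexx ?orbT.
Qed.

Lemma mcoeff_sqcup_int d (Q : seq {mpoly rat[d]}) (m : 'X_{1..d}) :
  (forall q, q \in Q -> q@_m \is a Num.int) -> (sqcup Q)@_m \is a Num.int.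
Proof.
move=> int_Q; rewrite mcoeff_sqcup big_seq.
elim/big_ind: _ => [| x y int_x int_y | q /int_Q]; first exact: rpred0.
  by rewrite /Num.max; case: ifP.
by move=> /intrP[z ->]; rewrite -intr_norm intr_int.
Qed.

Lemma norm_meval_le d (R : realDomainType) (p q : {mpoly R[d]}) (v : 'I_d -> R) :
    (forall m, `|q@_m| <= p@_m) ->
  `|q.@[v]| <= p.@[fun i => `|v i|].
Proof.
(* A common size bound lets both evaluations range over the same monomials. *)
move=> le_qp; pose k := maxn (msize p) (msize q).
rewrite /meval !(mmapE k) ?leq_max ?leqnn ?orbT //=.
apply: le_trans (ler_norm_sum _ _ _) _; apply: ler_sum => m _.
rewrite normrM /mmap1 normr_prod.
under eq_bigr => i _ do rewrite normrX.
by rewrite ler_wpM2r // prodr_ge0 // => i _; rewrite exprn_ge0.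
Qed.

Definition intr_mpoly d (p : {mpoly int[d]}) : {mpoly rat[d]} :=
  map_mpoly (fun z : int => z%:~R : rat) p.

Lemma mcoeff_intr_mpoly d (p : {mpoly int[d]}) (m : 'X_{1..d}) :
  (intr_mpoly p)@_m = (p@_m)%:~R.
Proof. exact: (mcoeff_map_mpoly (intr : {rmorphism int -> rat})). Qed.

Lemma integral_mpolyP d (p : {mpoly rat[d]}) :
  (forall m, p@_m \is a Num.int) -> exists q, intr_mpoly q = p.
Proof.
move=> int_p; exists (\sum_(m <- msupp p) numq p@_m *: 'X_[m]).
apply/mpolyP => m; rewrite mcoeff_intr_mpoly mcoeff_sum_scaleX ?msupp_uniq //.
case: ifPn => [_ | /memN_msupp_eq0-> //]; have /intrP[z ->] := int_p m.
by rewrite numq_int.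
Qed.

Lemma meval_intr_mpoly d (p : {mpoly int[d]}) (v : 'I_d -> int) :
  (intr_mpoly p).@[fun i => (v i)%:~R] = (p.@[v])%:~R.
Proof.
pose k := maxn (msize p) (msize (intr_mpoly p)).
rewrite /meval !(mmapE k) ?leq_max ?leqnn ?orbT //= raddf_sum /=.
apply: eq_bigr => m _; rewrite mcoeff_intr_mpoly rmorphM; congr (_ * _).
by rewrite /mmap1 rmorph_prod; apply: eq_bigr => i _; rewrite rmorphXn.
Qed.

Lemma meval_integral d (p : {mpoly rat[d]}) (s : state d) :
  (forall m, p@_m \is a Num.int) -> p.@[ratpoint s] \is a Num.int.
Proof.
move=> int_p; rewrite mevalE rpred_sum // => m _; rewrite rpredM // rpred_prod // => i _.
by rewrite rpredX // intr_int.
Qed.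

(** * Stabilization of signs and of atoms *)

Lemma peval_pe_expos d (e : pexpr d) (s : state d) (n : nat) :
  peval e s n = \sum_(i < size (pe_expos e))
    (pecoeff (nth expo_one (pe_expos e) i) e).@[ratpoint s] *
    (pe_mon (nth expo_one (pe_expos e) i) n)%:R.
Proof.
pose F k : rat := (pecoeff k e).@[ratpoint s] * (pe_mon k n)%:R.
rewrite -(big_mkord predT (fun i => F (nth expo_one (pe_expos e) i))).
rewrite -(big_nth expo_one predT F).
rewrite (perm_big (pesupp e)) ?perm_sort //=; apply: eq_bigr => k _.
by rewrite /F natrM !natrX mulrA.
Qed.

Lemma sgr_addl_small (R : realDomainType) (x y : R) :
  `|x| < `|y| -> Num.sg (x + y) = Num.sg y.
Proof.
case: (ltrgt0P y) => [y_gt0|y_lt0|->]; last by rewrite normr_lt0.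
  by rewrite ltr_norml => /andP[x_gt _]; rewrite !gtr0_sg //; lra.
by rewrite ltr_norml => /andP[_ x_lt]; rewrite !ltr0_sg //; lra.
Qed.

Lemma sgr_peval_stable d (e : pexpr d) (s : state d) (N n : nat) :
    integral_coeffs e -> (C_threshold e <= N)%N ->
    (forall q, q \in lower_polys e -> 2 * `|q.@[ratpoint s]| <= N%:R) ->
    (N <= n)%N ->
  Num.sg (peval e s n) = Num.sg (peval e s N).
Proof.
move=> int_e le_N le_p leNn; pose k i := nth expo_one (pe_expos e) i.
pose p i := (pecoeff (k i) e).@[ratpoint s]; pose l := size (pe_expos e).
pose psum m n := \sum_(i < m) p i * (pe_mon (k i) n)%:R.
rewrite !peval_pe_expos; change (Num.sg (psum l n) = Num.sg (psum l N)).
have int_p i : p i \is a Num.int by apply: meval_integral.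
pose P i := `|Num.floor (p i)|%N.
have normp i : `|p i| = (P i)%:R.
  by rewrite /P natr_absz -[p i in LHS](floorK (int_p i)) intr_norm.
have norm_psum m j : `|psum m j| <= (\sum_(i < m) P i * pe_mon (k i) j)%:R.
  rewrite natr_sum; apply: le_trans (ler_norm_sum _ _ _) _; apply: ler_sum => i _.
  by rewrite normrM normp natrM normr_nat.
have top m j : (m < l)%N -> (N <= j)%N -> (0 < (k m).1)%N -> p m != 0 ->
    Num.sg (psum m.+1 j) = Num.sg (p m).
  move=> ml leNj km pm0; have le_j := leq_trans le_N leNj.
  have j_gt0 : (0 < j)%N := leq_trans (C_threshold_gt0 e) le_j.
  have mon_gt0 := pe_mon_gt0 km j_gt0.
  rewrite /psum big_ord_recr /= sgr_addl_small.
    by rewrite sgrM [Num.sg _%:R]gtr0_sg ?mulr1 // ltr0n.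
  apply: le_lt_trans (norm_psum m j) _; rewrite normrM normp normr_nat -natrM ltr_nat.
  (* The coefficient is a nonzero integer, so [P m] is at least 1. *)
  apply: (@leq_trans (pe_mon (k m) j)); last first.
    by rewrite leq_pmull // lt0n -(eqr_nat rat) -normp normr_eq0.
  apply: leading_term_dominates => // i im.
  apply: leq_trans leNj; rewrite -(ler_nat rat) natrM -normp; apply: le_p.
  (* Since i < m < l, the coefficient with index i is never the topmost one and thus occurs in
     [lower_polys]. *)
  have lt_i : (i < l.-1)%N by lia.
  apply/mapP; exists (k i) => //; rewrite /k -(@nth_take l.-1) //.
  by rewrite mem_nth // size_takel // leq_pred.
have n_gt0 : (0 < N)%N := leq_trans (C_threshold_gt0 e) le_N.
have : (l <= l)%N by [].
(* Only the number of summands varies; the upper bound [l] stays fixed. *)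
elim: {1 3 4}l => [|m IHm] ml; first by rewrite /psum !big_ord0.
have := IHm (ltnW ml).
case: (posnP (k m).1) => [k0 | km].
  by rewrite /psum !big_ord_recr /= !(pe_mon0 k0) ?mulr0 ?addr0 //; lia.
case: (eqVneq (p m) 0) => [pm0 | pm0]; last by rewrite !top.
by rewrite /psum !big_ord_recr /= pm0 !mul0r !addr0.
Qed.

Lemma sat_eq_atoms d (f : formula d) (s t : state d) :
    (forall a, a \in atoms f -> (a.1.@[s] < a.2.@[s]) = (a.1.@[t] < a.2.@[t])) ->
  sat s f = sat t f.
Proof.
elim: f => [a | f IHf g IHg | f IHf g IHg] /= eq_st; first by rewrite eq_st ?mem_head.
  by rewrite IHf ?IHg // => a a_in; rewrite eq_st // mem_cat a_in ?orbT.
by rewrite IHf ?IHg // => a a_in; rewrite eq_st // mem_cat a_in ?orbT.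
Qed.

Lemma atom_stable d (L : loop d) (X : d.-tuple (pexpr d)) (n0 : nat) (a : atom d)
    (o : overapprox d) (s : state d) (N n : nat) :
    closed_form (loop_eta L) X n0 ->
    valid_overapprox (loop_psi' L) (npe X a) o ->
    eventually_nonpos (loop_psi' L) (npe X a) o ->
    sat s (loop_psi' L) ->
    (n0 <= N)%N -> (C_threshold (oa_expr (npe X a) o) <= N)%N ->
    (oa_threshold o <= N)%N ->
    (forall q, q \in lower_polys (oa_expr (npe X a) o) ->
       2 * `|q.@[ratpoint s]| <= N%:R) ->
    (N <= n)%N ->
  let s_ k := iter k (flow (loop_eta L)) s in
  (a.1.@[s_ n] < a.2.@[s_ n]) = (a.1.@[s_ N] < a.2.@[s_ N]).
Proof.
move=> closedX valid_o nonpos_o sat_s le_n0 le_C le_D le_p leNn /=.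
have int_o : integral_coeffs (oa_expr (npe X a) o).
  exact/oa_expr_integral/npe_integral.
have stable := sgr_peval_stable int_o le_C le_p.
rewrite -!(npe_gt0 _ _ closedX) ?(leq_trans le_n0) //.
case: (Classical_Prop.classic (oa_expr (npe X a) o = npe X a)) => [eq_o | neq_o].
  by rewrite -eq_o -[LHS]sgr_gt0 -[RHS]sgr_gt0 stable.
have [m nonpos_m] := nonpos_o neq_o s sat_s.
have oa_le0 k : (N <= k)%N -> peval (oa_expr (npe X a) o) s k <= 0.
  (* The sign at [maxn m N] is known to be nonpositive, and stability carries it back to N and on to
     k. *)
  move=> leNk; rewrite -sgr_le0 stable // -(stable (maxn m N)) ?leq_maxr // sgr_le0.
  by rewrite nonpos_m ?leq_maxl.
have npe_le0 k : (N <= k)%N -> (0 < peval (npe X a) s k) = false.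
  move=> leNk; apply/negbTE; rewrite -leNgt; apply: le_trans (oa_le0 k leNk).
  apply: (peval_oa_expr_ge valid_o) => //; last exact: leq_trans leNk.
  by apply: leq_trans (C_threshold_gt0 _) (leq_trans le_C leNk).
by rewrite !npe_le0.
Qed.

(** * Evaluations of the loop and termination *)

Lemma evaluation_Loc1 d (L : loop d) (s : state d) (ss : seq trans) (c c' : config d) :
    evaluation L c ss c' -> c = (Loc1, s) ->
  forall k, (k < size ss)%N -> sat (iter k (flow (loop_eta L)) s) (loop_phi L).
Proof.
move=> ev; elim: ev s => {c ss c'} // c t c1 ss c' [src_t tgt_t guard_t upd_t] _ IH s def_c.
move: src_t guard_t upd_t; rewrite {}def_c /=; case: t tgt_t => // tgt1 _ guard_t upd_t.
case=> [|k] ltk //; rewrite iterSr; apply: IH => //.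
rewrite (surjective_pairing c1) tgt1; congr (_, _).
by apply/ffunP => i; rewrite upd_t ffunE.
Qed.

Lemma evaluation_Loc0 d (L : loop d) (s : state d) (ss : seq trans) (c' : config d) :
    evaluation L (Loc0, s) ss c' ->
  ss = [::] \/ exists2 ss', ss = T0 :: ss' &
     sat s (loop_psi L) /\ evaluation L (Loc1, s) ss' c'.
Proof.
move def_c : (Loc0, s) => c ev.
case: ev def_c => [|{}c t c1 ss1 c2 [src_t tgt_t guard_t upd_t] ev] def_c; first by left.
right; move: src_t guard_t upd_t; rewrite -def_c /=; case: t tgt_t => //= tgt1 _ guard_t upd_t.
exists ss1 => //; split=> //; suff <- : c1 = (Loc1, s) by [].
rewrite (surjective_pairing c1) tgt1; congr (_, _).
by apply/ffunP => i; rewrite upd_t tnth_mktuple mevalXU.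
Qed.

Lemma evaluation_Loc1_T1 d (L : loop d) (ss : seq trans) (c c' : config d) :
  evaluation L c ss c' -> c.1 = Loc1 -> all (pred1 T1) ss.
Proof.
elim=> {c ss c'} // c t c1 ss c' [src_t tgt_t _ _] _ IH c_Loc1.
by move: src_t; rewrite c_Loc1; case: t tgt_t => // tgt1 _; exact: IH.
Qed.

(** Otherwise one initial step followed by looping steps forever is an infinite evaluation. Its
    states lag one index behind the configurations because the initial transition leaves the state
    unchanged. *)
Lemma terminating_exit d (L : loop d) (s : state d) :
    terminating L -> sat s (loop_psi L) ->
  exists k, ~~ sat (iter k (flow (loop_eta L)) s) (loop_phi L).
Proof.
move=> termL psi_s; apply: Classical_Prop.NNPP => no_exit; apply: termL.
exists (fun k => if k is k'.+1 then (Loc1, iter k' (flow (loop_eta L)) s)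
                 else (Loc0, s)).
split=> // -[|k].
  by exists T0; split=> //= i; rewrite tnth_mktuple mevalXU.
exists T1; split=> //= [|i]; last by rewrite ffunE.
by apply: contraT => exit_k; case: no_exit; exists k.
Qed.

(** * The bounding polynomial and the main result *)

Section SthSqcup.
Variables (d : nat) (L : loop d) (X : d.-tuple (pexpr d)) (n0 : nat).
Variable oa : atom d -> overapprox d.

Lemma mcoeff_sth_sqcup (m : 'X_{1..d}) :
  (sth_sqcup L X n0 oa)@_m = (sqcup (Pol L X oa))@_m *+ 2 +
    (maxn n0 (maxn (C_max L X oa) (D_max L oa)) * (m == 0%MM))%:R.
Proof.
by rewrite /sth_sqcup mcoeffD mulr_natl !mcoeffMn mcoeff1 -mulrnA mulnC.
Qed.

Lemma mcoeff_sth_sqcup_int (m : 'X_{1..d}) : (sth_sqcup L X n0 oa)@_m \is a Num.int.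
Proof.
rewrite mcoeff_sth_sqcup rpredD ?rpred_nat // rpredMn // mcoeff_sqcup_int // => q.
move=> /flatten_mapP[a _ /mapP[k _ ->]].
exact: (oa_expr_integral (oa a) (npe_integral X a)).
Qed.

Lemma mcoeff_sth_sqcup_ge0 (m : 'X_{1..d}) : 0 <= (sth_sqcup L X n0 oa)@_m.
Proof. by rewrite mcoeff_sth_sqcup addr_ge0 ?ler0n // mulrn_wge0 // mcoeff_sqcup_ge0. Qed.

Lemma meval_sth_sqcup (v : 'I_d -> rat) :
  (sth_sqcup L X n0 oa).@[v] = 2 * (sqcup (Pol L X oa)).@[v] +
    (maxn n0 (maxn (C_max L X oa) (D_max L oa)))%:R.
Proof. by rewrite /sth_sqcup mevalD mulr_natl !mevalMn meval1 mulr_natl. Qed.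

End SthSqcup.

Lemma sat_stable d (L : loop d) (X : d.-tuple (pexpr d)) (n0 : nat)
    (oa : atom d -> overapprox d) (s : state d) (N n : nat) :
    closed_form (loop_eta L) X n0 ->
    (forall a, a \in atoms (loop_phi L) ->
       valid_overapprox (loop_psi' L) (npe X a) (oa a)) ->
    (forall a, a \in atoms (loop_phi L) ->
       eventually_nonpos (loop_psi' L) (npe X a) (oa a)) ->
    sat s (loop_psi' L) ->
    (sth_sqcup L X n0 oa).@[fun i => `|ratpoint s i|] <= N%:R -> (N <= n)%N ->
  sat (iter n (flow (loop_eta L)) s) (loop_phi L) =
  sat (iter N (flow (loop_eta L)) s) (loop_phi L).
Proof.
move=> closedX oa_valid oa_nonpos sat_s; rewrite meval_sth_sqcup => le_BN leNn.
(* Nonnegativity of this part lets N dominate the constant n0, C, D; conversely, the nonnegative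
   constant is dropped below to bound the lower coefficients. *)
have sq_ge0 : 0 <= (sqcup (Pol L X oa)).@[fun i => `|ratpoint s i|].
  rewrite mevalE sumr_ge0 // => m _; rewrite mulr_ge0 ?mcoeff_sqcup_ge0 //.
  by rewrite prodr_ge0 // => i _; rewrite exprn_ge0.
have : (maxn n0 (maxn (C_max L X oa) (D_max L oa)) <= N)%N.
  by rewrite -(ler_nat rat); apply: le_trans le_BN; rewrite lerDr mulr_ge0.
rewrite !geq_max => /and3P[le_n0 le_C le_D]; apply: sat_eq_atoms => a a_phi.
apply: (atom_stable closedX (oa_valid _ a_phi) (oa_nonpos _ a_phi)) => //.
- apply: leq_trans le_C.
  exact: (leq_bigmax_seq a (F := fun a => C_threshold (oa_expr (npe X a) (oa a)))).
- by apply: leq_trans le_D; exact: (leq_bigmax_seq a (F := fun a => oa_threshold (oa a))).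
move=> q q_a; apply: le_trans le_BN; apply: ler_wpDr; rewrite ?ler0n // ler_pM2l //.
apply: norm_meval_le => m; apply: mcoeff_le_sqcup; apply/flatten_mapP.
by exists a.
Qed.

Theorem theorem27 (d : nat) (L : loop d) (X : d.-tuple (pexpr d)) (n0 : nat)
    (oa : atom d -> overapprox d)
    (tnnL : tnn_loop L)
    (termL : terminating L)
    (normX : forall i, normalized (tnth X i))
    (closedX : closed_form (loop_eta L) X n0)
    (oa_valid : forall a, a \in atoms (loop_phi L) ->
       valid_overapprox (loop_psi' L) (npe X a) (oa a))
    (oa_nonpos : forall a, a \in atoms (loop_phi L) ->
       eventually_nonpos (loop_psi' L) (npe X a) (oa a)) :
  exists2 S : {mpoly int[d]},
    map_mpoly (fun z : int => z%:~R : rat) S = sth_sqcup L X n0 oa &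
    (forall s : state d, sat s (loop_psi' L) ->
       exists2 m : nat, is_sth L s m & m%:Z <= S.@[fun i => `|s i|]) /\
    global_runtime_bound L (RB_glo S).
Proof.
have [S defS] := integral_mpolyP (mcoeff_sth_sqcup_int L X n0 oa).
have S_ge0 m : 0 <= S@_m.
  by rewrite -(ler0z rat) -mcoeff_intr_mpoly defS mcoeff_sth_sqcup_ge0.
have evalS (s : state d) : exists2 N : nat,
    beval (fun i => `|s i|%N) (bound_of_mpoly S) = Some N & S.@[fun i => `|s i|] = N%:Z.
  have [N bevalN evalN] := beval_bound_of_mpoly (fun i => `|s i|%N) S_ge0.
  by exists N => //; rewrite -evalN; apply: meval_eq => i; rewrite abszE.
have stable (s : state d) (N : nat) :
    sat s (loop_psi' L) -> S.@[fun i => `|s i|] = N%:Z ->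
    forall n, (N <= n)%N -> sat (iter n (flow (loop_eta L)) s) (loop_phi L) =
                            sat (iter N (flow (loop_eta L)) s) (loop_phi L).
  move=> sat_s evalN n; apply: (sat_stable closedX oa_valid oa_nonpos sat_s).
  rewrite -defS -(@meval_eq _ _ (fun i => `|s i|%:~R)); last first.
    by move=> i; rewrite intr_norm.
  by rewrite meval_intr_mpoly evalN.
exists S; first exact: defS; split=> [s sat_s | s0 s ss c].
  have [N _ evalN] := evalS s.
  pose st m := forall n, (m <= n)%N ->
    sat s (iter n (fsubst (loop_eta L)) (loop_phi L)) =
    sat s (iter m (fsubst (loop_eta L)) (loop_phi L)).
  have stN : st N by move=> n leNn; rewrite !sat_iter_fsubst; apply: stable.
  have [m st_m min_m] := ex_min_nat stN.
  by exists m; [split | rewrite evalN lez_nat min_m].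
move=> /evaluation_Loc0[-> | [ss' -> [psi_s0 ev]]].
  by case: (s) => //=; have [N -> _] := evalS s0.
have all1 := evaluation_Loc1_T1 ev (erefl _).
case: s => /=.
  rewrite -[1%N]addn0 leq_add2l leqn0 -leqn0 leqNgt -has_count -all_predC.
  by apply: sub_all all1 => -[].
have [N -> evalN] := evalS s0; rewrite /= add0n.
(* More than N looping steps mean that the guard holds at all iterates 0, ..., N. The iterate 0
   places the initial state in [loop_psi'], so stability applies. *)
rewrite leqNgt; apply/negP => ltN; have {}ltN := leq_trans ltN (count_size _ _).
have phi_lt := evaluation_Loc1 ev (erefl _).
have sat_s0 : sat s0 (loop_psi' L).
  by rewrite /= psi_s0 (phi_lt 0%N) // (leq_ltn_trans _ ltN).
(* Termination gives an iterate k violating the guard: k < N contradicts the steps taken, and k >= N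
   contradicts stability, as the guard holds at N. *)
have [k /negP[]] := terminating_exit termL psi_s0.
case: (ltnP k N) => [ltkN | leNk]; first by rewrite phi_lt // (ltn_trans ltkN).
by rewrite (stable s0 N) // phi_lt.
Qed.
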